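(* Let $\mathrm{Ax}$ be a set of consequence pairs each of which is one of $\mathsf{pnp}:\ p\wedge(p\Rightarrow\bot)\trianglelefteq\bot$, $\mathsf{mp}:\ p\wedge(p\Rightarrow q)\trianglelefteq q$, $\mathsf{veq}:\ p\trianglelefteq q\Rightarrow p$, $\mathsf{det}:\ \top\Rightarrow p\trianglelefteq p$, $\mathsf{expl}:\ \top\trianglelefteq\bot\Rightarrow p$, or is a consequence pair containing no occurrence of $\Rightarrow$. Then $\mathbf{CL}(\mathrm{Ax})$ is sound and complete with respect to the class of selection L-frames that validate every consequence pair in $\mathrm{Ax}$: a consequence pair belongs to $\mathbf{CL}(\mathrm{Ax})$ iff it is validated by every selection L-frame validating all of $\mathrm{Ax}$.
   Context: Formulas: $\phi::=p\mid\top\mid\bot\mid\phi\wedge\phi\mid\phi\vee\phi\mid\phi\Rightarrow\phi$. $\mathbf{CL}(\Gamma)$ is the smallest set of consequence pairs $\phi\trianglelefteq\psi$ containing $\Gamma$, closed under uniform substitution, containing $p\trianglelefteq\top$, $\bot\trianglelefteq p$, $p\trianglelefteq p$, $p\wedge q\trianglelefteq p$, $p\wedge q\trianglelefteq q$, $p\trianglelefteq p\vee q$, $q\trianglelefteq p\vee q$, $\top\trianglelefteq p\Rightarrow\top$, $p\Rightarrow(q\wedge r)\trianglelefteq(p\Rightarrow q)\wedge(p\Rightarrow r)$, $(p\Rightarrow q)\wedge(p\Rightarrow r)\trianglelefteq p\Rightarrow(q\wedge r)$, closed under transitivity, $\wedge$-introduction (from $r\trianglelefteq p,r\trianglelefteq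 q$ infer $r\trianglelefteq p\wedge q$), $\vee$-elimination (from $p\trianglelefteq r,q\trianglelefteq r$ infer $p\vee q\trianglelefteq r$), and congruence for $\Rightarrow$ in each argument. A selection L-frame is a meet-semilattice $(X,1,\curlywedge)$ ($x\preccurlyeq y$ iff $x\curlywedge y=x$) with $s:X\times\mathcal F(X)\to\mathcal F(X)$ ($\mathcal F(X)$ the filters: upward closed, closed under finite meets) such that $s(1,a)=\{1\}$; $x\preccurlyeq y$ implies $s(y,a)\subseteq s(x,a)$; if $z\in s(x\curlywedge y,a)$ there are $u\in s(x,a)$, $v\in s(y,a)$ with $u\curlywedge v\preccurlyeq z$. Under a valuation $V$ (letters to filters): $x\Vdash p$ iff $x\in V(p)$; $\top$ always; $x\Vdash\bot$ iff $x=1$; $\wedge$ pointwise; $x\Vdash\phi\vee\psi$ iff some $y\Vdash\phi$, $z\Vdash\psi$ have $y\curlywedge z\preccurlyeq x$; $x\Vdash\phi\Rightarrow\psi$ iff $s(x,[\![\phi]\!])\subseteq[\![\psi]\!]$. A frame validates $\phi\trianglelefteq\psi$ if $[\![\phi]\!]\subseteq[\![\psi]\!]$ for all valuations. *)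

(* Defs.v *)
From HB Require Import structures.
From mathcomp Require Import all_boot all_order.
From mathcomp Require Import boolp classical_sets.

Set Implicit Arguments.
Unset Strict Implicit.
Unset Printing Implicit Defensive.

Import Order.Theory.

Local Open Scope classical_set_scope.
Local Open Scope order_scope.

Inductive formula (L : Type) : Type :=
| Var of L
| Top
| Bot
| And of formula L & formula L
| Or of formula L & formula L
| Imp of formula L & formula L.

Arguments Top {L}.
Arguments Bot {L}.

Declare Scope cl_scope.
Delimit Scope cl_scope with CL.
Bind Scope cl_scope with formula.
Notation "⊤" := Top (at level 0) : cl_scope.
Notation "⊥" := Bot (at level 0) : cl_scope.
Notation "A ∧ B" := (And A B) (at level 40, left associativity) : cl_scope.
Notation "A ∨ B" := (Or A B) (at level 50, left associativity) : cl_scope.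
Notation "A ⇒ B" := (Imp A B) (at level 55, right associativity) : cl_scope.

Fixpoint subst (L : Type) (sigma : L -> formula L) (phi : formula L) :
    formula L :=
  match phi with
  | Var p => sigma p
  | Top => Top
  | Bot => Bot
  | And A B => And (subst sigma A) (subst sigma B)
  | Or A B => Or (subst sigma A) (subst sigma B)
  | Imp A B => Imp (subst sigma A) (subst sigma B)
  end.

Fixpoint imp_free (L : Type) (phi : formula L) : bool :=
  match phi with
  | Var _ | Top | Bot => true
  | And A B | Or A B => imp_free A && imp_free B
  | Imp _ _ => false
  end.

Record cpair (L : Type) : Type := Cpair { lhs : formula L; rhs : formula L }.

Notation "A ⊴ B" := (Cpair A%CL B%CL) (at level 60, no associativity)
  : cl_scope.
Bind Scope cl_scope with cpair.
Local Open Scope cl_scope.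

(* The axioms are stated for arbitrary formulas A, B, C rather than for letters
   p, q, r.  Because of [CL_subst] this is the same thing as soon as there are
   three letters, and it keeps the definition meaningful for any type L. *)
Inductive CL (L : Type) (Gamma : set (cpair L)) : cpair L -> Prop :=
| CL_ax c : Gamma c -> CL Gamma c
| CL_subst sigma A B :
    CL Gamma (A ⊴ B) -> CL Gamma (subst sigma A ⊴ subst sigma B)
| CL_top A : CL Gamma (A ⊴ ⊤)
| CL_bot A : CL Gamma (⊥ ⊴ A)
| CL_refl A : CL Gamma (A ⊴ A)
| CL_andl A B : CL Gamma (A ∧ B ⊴ A)
| CL_andr A B : CL Gamma (A ∧ B ⊴ B)
| CL_orl A B : CL Gamma (A ⊴ A ∨ B)
| CL_orr A B : CL Gamma (B ⊴ A ∨ B)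
| CL_imp_top A : CL Gamma (⊤ ⊴ A ⇒ ⊤)
| CL_imp_and A B C : CL Gamma (A ⇒ (B ∧ C) ⊴ (A ⇒ B) ∧ (A ⇒ C))
| CL_and_imp A B C : CL Gamma ((A ⇒ B) ∧ (A ⇒ C) ⊴ A ⇒ (B ∧ C))
| CL_trans A B C : CL Gamma (A ⊴ B) -> CL Gamma (B ⊴ C) -> CL Gamma (A ⊴ C)
| CL_andI A B C : CL Gamma (C ⊴ A) -> CL Gamma (C ⊴ B) -> CL Gamma (C ⊴ A ∧ B)
| CL_orE A B C : CL Gamma (A ⊴ C) -> CL Gamma (B ⊴ C) -> CL Gamma (A ∨ B ⊴ C)
| CL_congl A B C :
    CL Gamma (A ⊴ B) -> CL Gamma (B ⊴ A) -> CL Gamma (A ⇒ C ⊴ B ⇒ C)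
| CL_congr A B C :
    CL Gamma (A ⊴ B) -> CL Gamma (B ⊴ A) -> CL Gamma (C ⇒ A ⊴ C ⇒ B).

Definition pnp (L : Type) (p : L) : cpair L :=
  Var p ∧ (Var p ⇒ ⊥) ⊴ ⊥.
Definition mp (L : Type) (p q : L) : cpair L :=
  Var p ∧ (Var p ⇒ Var q) ⊴ Var q.
Definition veq (L : Type) (p q : L) : cpair L :=
  Var p ⊴ Var q ⇒ Var p.
Definition det (L : Type) (p : L) : cpair L :=
  ⊤ ⇒ Var p ⊴ Var p.
Definition expl (L : Type) (p : L) : cpair L :=
  ⊤ ⊴ ⊥ ⇒ Var p.

(* The names of the letters are immaterial, but p and q must be distinct. *)
Variant admissible (L : Type) : cpair L -> Prop :=
| adm_pnp p : admissible (pnp p)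
| adm_mp p q : p <> q -> admissible (mp p q)
| adm_veq p q : p <> q -> admissible (veq p q)
| adm_det p : admissible (det p)
| adm_expl p : admissible (expl p)
| adm_imp_free A B : imp_free A -> imp_free B -> admissible (A ⊴ B).

(* Lets a filter be applied to a point. *)
Identity Coercion set_fun : set >-> Funclass.

(* Filters are closed under all finite meets, so they contain \top. *)
Record filt (d : Order.disp_t) (X : tMeetSemilatticeType d) : Type := Filt {
  filt_set :> set X;
  filt_up : forall x y : X, x <= y -> filt_set x -> filt_set y;
  filt_top : filt_set \top;
  filt_meet : forall x y : X, filt_set x -> filt_set y -> filt_set (x `&` y)
}.

Lemma filt_inj (d : Order.disp_t) (X : tMeetSemilatticeType d) (a b : filt X) :
  (a : set X) = b -> a = b.
Proof.
case: a b => [a ua ta ma] [b ub tb mb] /= eq_ab; subst b.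
by congr Filt; apply: Prop_irrelevance.
Qed.

Record sel_frame : Type := SelFrame {
  frame_disp : Order.disp_t;
  frame_car :> tMeetSemilatticeType frame_disp;
  sel : frame_car -> filt frame_car -> filt frame_car;
  sel_top : forall a, sel \top a = [set \top] :> set frame_car;
  sel_anti : forall (x y : frame_car) a, x <= y -> sel y a `<=` sel x a;
  sel_meet : forall (x y : frame_car) a z, sel (x `&` y) a z ->
    exists u v, [/\ sel x a u, sel y a v & u `&` v <= z]
}.

Section FilterOperations.
#[local] Obligation Tactic := idtac.
Context (F : sel_frame).
Implicit Types (a b : filt F) (x y z : F).

Program Definition filtT : filt F := @Filt _ F setT _ _ _.
Next Obligation. by []. Qed.
Next Obligation. by []. Qed.
Next Obligation. by []. Qed.

Program Definition filtB : filt F := @Filt _ F [set x | x = \top] _ _ _.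
Next Obligation. by move=> x y /[swap] /= ->; rewrite le1x => /eqP. Qed.
Next Obligation. by []. Qed.
Next Obligation. by move=> x y /= -> ->; rewrite meetxx. Qed.

Program Definition filtI a b : filt F := @Filt _ F [set x | a x /\ b x] _ _ _.
Next Obligation.
by move=> a b x y xy [ax bx]; split; [apply: filt_up ax | apply: filt_up bx].
Qed.
Next Obligation. by move=> a b; split; apply: filt_top. Qed.
Next Obligation.
by move=> a b x y [ax bx] [ay b_y]; split; apply: filt_meet.
Qed.

Program Definition filtU a b : filt F :=
  @Filt _ F [set x | exists y z, [/\ a y, b z & y `&` z <= x]] _ _ _.
Next Obligation.
move=> a b x x' xx' [y [z [ay bz yzx]]].
by exists y, z; split => //; apply: le_trans xx'.
Qed.
Next Obligation.
by move=> a b; exists \top, \top; split; rewrite ?lex1 //; apply: filt_top.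
Qed.
Next Obligation.
move=> a b x x' [y [z [ay bz yzx]]] [y' [z' [ay' bz' yzx']]].
exists (y `&` y'), (z `&` z'); split; [exact: filt_meet..|].
by rewrite meetACA leI2.
Qed.

Program Definition filtS a b : filt F :=
  @Filt _ F [set x | sel x a `<=` b] _ _ _.
Next Obligation.
by move=> a b x y xy xab; apply: subset_trans xab; apply: sel_anti.
Qed.
Next Obligation. by move=> a b; rewrite /= sel_top => _ ->; apply: filt_top. Qed.
Next Obligation.
move=> a b x y xab yab z /sel_meet[u [v [xu yv uvz]]].
by apply: (filt_up uvz); apply: filt_meet; [apply: xab | apply: yab].
Qed.

End FilterOperations.

(* [interp V phi] is the truth set of phi, as a filter. *)
Fixpoint interp (L : Type) (F : sel_frame) (V : L -> filt F)
    (phi : formula L) : filt F :=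
  match phi with
  | Var p => V p
  | Top => filtT F
  | Bot => filtB F
  | And A B => filtI (interp V A) (interp V B)
  | Or A B => filtU (interp V A) (interp V B)
  | Imp A B => filtS (interp V A) (interp V B)
  end.

Definition validates (L : Type) (F : sel_frame) (c : cpair L) : Prop :=
  forall V : L -> filt F, interp V (lhs c) `<=` interp V (rhs c).

(* Main.v *)
From HB Require Import structures.
Require Import Defs.
From mathcomp Require Import all_boot all_order.
From mathcomp Require Import boolp classical_sets.

(** Completeness uses the canonical frame whose points are the theories (the
    filters of the Lindenbaum algebra) ordered by inclusion.  The relation
    [sel x a] is the principal filter generated by [{B | A ⇒ B ∈ x}] if [a] is
    the truth set of [A], and by [x] itself if [a] is not definable; the latter
    choice satisfies the frame conditions of [pnp], [mp] and [veq] at once,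
    whereas [det] and [expl] only concern definable filters.  Axioms without
    implication are canonical by a Baker-Hales style argument: under an
    arbitrary valuation [V], [x] forces [A] iff there are theories [f p ∈ V p]
    such that [x] contains every instance [A[s]] with [s p ∈ f p], so that
    closure of the logic under substitution carries over to the frame. *)

Set Implicit Arguments.
Unset Strict Implicit.
Unset Printing Implicit Defensive.

Import Order.Theory.

Local Open Scope classical_set_scope.
Local Open Scope order_scope.
Local Open Scope cl_scope.

(** * Soundness over an arbitrary selection L-frame *)

Section Soundness.
Context (L : Type).

Lemma interp_subst (F : sel_frame) (V : L -> filt F) (s : L -> formula L) A :
  interp V (subst s A) = interp (fun p => interp V (s p)) A.
Proof.
by elim: A => [p|||A IHA B IHB|A IHA B IHB|A IHA B IHB] //=;
  rewrite IHA IHB.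
Qed.

Lemma CL_sound (Ax : set (cpair L)) c (F : sel_frame) :
  CL Ax c -> (forall e, Ax e -> validates F e) -> validates F c.
Proof.
move=> cl FAx; elim: cl => {c}.
- by move=> c /FAx.
- by move=> s A B _ AB V; rewrite /= !interp_subst; apply: AB.
- by move=> A V x.
- by move=> A V x /= ->; apply: filt_top.
- by move=> A V x.
- by move=> A B V x [].
- by move=> A B V x [].
- move=> A B V x Ax'; exists x, \top.
  by split; [|exact: filt_top|exact: leIl].
- move=> A B V x Bx; exists \top, x.
  by split; [exact: filt_top| |exact: leIr].
- by move=> A V x _ y.
- by move=> A B C V x ABC; split=> y /ABC[].
- by move=> A B C V x [hB hC] y xy; split; [apply: hB | apply: hC].
- by move=> A B C _ AB _ BC V; apply: subset_trans (AB V) (BC V).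
- by move=> A B C _ CA _ CB V x Cx; split; [apply: CA | apply: CB].
- move=> A B C _ hA _ hB V x [y [z [/hA yC /hB zC yzx]]].
  by apply: (filt_up yzx); apply: filt_meet.
(* Selection takes a filter as argument, so the two truth sets must be identified as filters, not
   merely compared pointwise. *)
- move=> A B C _ AB _ BA V x /=.
  suff -> : interp V A = interp V B by [].
  by apply: filt_inj; apply/seteqP; split; [exact: AB|exact: BA].
- move=> A B C _ AB _ BA V x /= CA.
  exact: subset_trans CA (AB V).
Qed.

End Soundness.

(** * Derived monotonicity rules and formula instances of the axioms *)

Section DerivedRules.
Context (L : Type) (Ax : set (cpair L)).
Implicit Types (A B C D : formula L) (p q : L).
Notation "A |- B" := (CL Ax (A ⊴ B)) (at level 70).

Lemma CL_and_mono A B C D : A |- C -> B |- D -> A ∧ B |- C ∧ D.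
Proof.
move=> hA hB; apply: CL_andI.
  exact: CL_trans (CL_andl _ _ _) hA.
exact: CL_trans (CL_andr _ _ _) hB.
Qed.

Lemma CL_or_mono A B C D : A |- C -> B |- D -> A ∨ B |- C ∨ D.
Proof.
move=> hA hB; apply: CL_orE.
  exact: CL_trans hA (CL_orl _ _ _).
exact: CL_trans hB (CL_orr _ _ _).
Qed.

(** Only congruence is primitive: [B] is equivalent to [B ∧ C], and [A ⇒ (B ∧ C)] splits into its
    two components. *)
Lemma CL_imp_mono A B C : B |- C -> A ⇒ B |- A ⇒ C.
Proof.
move=> BC; have BBC : B |- B ∧ C by apply: CL_andI => //; apply: CL_refl.
apply: (CL_trans (CL_congr _ BBC (CL_andl _ _ _))).
exact: CL_trans (CL_imp_and _ _ _ _) (CL_andr _ _ _).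
Qed.

(** Monotonicity could fail only in the antecedent of an implication. The use is to compare two
    substitutions with their pointwise conjunction. *)
Lemma CL_subst_mono (s t : L -> formula L) A :
  imp_free A -> (forall p, s p |- t p) -> subst s A |- subst t A.
Proof.
move=> + st; elim: A => [p|||A IHA B IHB|A IHA B IHB|//] //=.
- by move=> _; apply: CL_refl.
- by move=> _; apply: CL_refl.
- by case/andP=> /IHA ? /IHB ?; apply: CL_and_mono.
- by case/andP=> /IHA ? /IHB ?; apply: CL_or_mono.
Qed.

(** The default [⊤] belongs to every theory, so in [interp_instances] only the value at [p] needs
    checking. *)
Definition subst1 p A : L -> formula L :=
  fun r => if pselect (r = p) then A else ⊤.
Definition subst2 p q A B : L -> formula L :=
  fun r => if pselect (r = p) then A else if pselect (r = q) then B else ⊤.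

Lemma subst1E p A : subst1 p A p = A.
Proof. by rewrite /subst1; case: pselect. Qed.

Lemma subst2l p q A B : subst2 p q A B p = A.
Proof. by rewrite /subst2; case: pselect. Qed.

Lemma subst2r p q A B : p <> q -> subst2 p q A B q = B.
Proof.
by move=> pq; rewrite /subst2; case: pselect => [/esym/pq//|?]; case: pselect.
Qed.

Lemma CL_pnp p A : Ax (pnp p) -> A ∧ (A ⇒ ⊥) |- ⊥.
Proof. by move/CL_ax/(CL_subst (subst1 p A)); rewrite /= subst1E. Qed.

Lemma CL_mp p q A B : p <> q -> Ax (mp p q) -> A ∧ (A ⇒ B) |- B.
Proof.
by move=> pq /CL_ax/(CL_subst (subst2 p q A B)); rewrite /= subst2l subst2r.
Qed.

Lemma CL_veq p q A B : p <> q -> Ax (veq p q) -> A |- B ⇒ A.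
Proof.
by move=> pq /CL_ax/(CL_subst (subst2 p q A B)); rewrite /= subst2l subst2r.
Qed.

Lemma CL_det p A : Ax (det p) -> ⊤ ⇒ A |- A.
Proof. by move/CL_ax/(CL_subst (subst1 p A)); rewrite /= subst1E. Qed.

Lemma CL_expl p A : Ax (expl p) -> ⊤ |- ⊥ ⇒ A.
Proof. by move/CL_ax/(CL_subst (subst1 p A)); rewrite /= subst1E. Qed.

End DerivedRules.

(** * The meet-semilattice of theories *)

Record theory (L : Type) (Ax : set (cpair L)) : Type := Theory {
  theory_set :> set (formula L);
  theory_up : forall A B, CL Ax (A ⊴ B) -> theory_set A -> theory_set B;
  theory_top : theory_set ⊤;
  theory_and : forall A B, theory_set A -> theory_set B -> theory_set (A ∧ B)
}.

HB.instance Definition _ (L : Type) (Ax : set (cpair L)) :=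
  gen_eqMixin (theory Ax).
HB.instance Definition _ (L : Type) (Ax : set (cpair L)) :=
  gen_choiceMixin (theory Ax).

Section Theories.
Context (L : Type) (Ax : set (cpair L)).
Implicit Types (A B C : formula L) (x y z : theory Ax).
Notation "A |- B" := (CL Ax (A ⊴ B)) (at level 70).
#[local] Obligation Tactic := idtac.

Lemma theory_inj x y : (x : set (formula L)) = y -> x = y.
Proof.
case: x y => [x ux tx mx] [y uy ty my] /= eq_xy; subst y.
by congr Theory; apply: Prop_irrelevance.
Qed.

Definition theory_le x y : bool := `[< x `<=` y >].

Lemma theory_le_refl : reflexive theory_le.
Proof. by move=> x; apply/asboolP. Qed.

Lemma theory_le_anti : antisymmetric theory_le.
Proof.
move=> x y /andP[/asboolP xy /asboolP yx].
by apply: theory_inj; apply/seteqP.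
Qed.

Lemma theory_le_trans : transitive theory_le.
Proof.
move=> y x z /asboolP xy /asboolP yz; apply/asboolP; exact: subset_trans yz.
Qed.

HB.instance Definition _ := Order.Le_isPOrder.Build
  (Order.Disp tt tt) (theory Ax) theory_le_refl theory_le_anti theory_le_trans.

Lemma theory_leP x y : reflect (x `<=` y) (x <= y).
Proof. exact: asboolP. Qed.

Program Definition theoryT : theory Ax := @Theory L Ax setT _ _ _.
Next Obligation. by []. Qed.
Next Obligation. by []. Qed.
Next Obligation. by []. Qed.

Program Definition theoryI x y : theory Ax := @Theory L Ax (x `&` y)%classic _ _ _.
Next Obligation.
by move=> x y A B AB [xA yA]; split; apply: theory_up AB _.
Qed.
Next Obligation. by move=> x y; split; apply: theory_top. Qed.
Next Obligation.
by move=> x y A B [xA yA] [xB yB]; split; apply: theory_and.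
Qed.

Lemma theory_lex1 x : x <= theoryT.
Proof. exact/theory_leP. Qed.

HB.instance Definition _ :=
  Order.hasTop.Build _ (theory Ax) theory_lex1.

Lemma theory_lexI x y z : (x <= theoryI y z) = (x <= y) && (x <= z).
Proof.
apply/theory_leP/andP => [xyz|[/theory_leP xy /theory_leP xz]].
  by split; apply/theory_leP => A /xyz[].
by move=> A xA; split; [apply: xy | apply: xz].
Qed.

HB.instance Definition _ :=
  Order.POrder_isMeetSemilattice.Build _ (theory Ax) theory_lexI.

Program Definition theory_gen A : theory Ax := @Theory L Ax [set B | A |- B] _ _ _.
Next Obligation. by move=> A B C BC AB; apply: CL_trans AB BC. Qed.
Next Obligation. by move=> A; apply: CL_top. Qed.
Next Obligation. by move=> A B C; apply: CL_andI. Qed.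

Program Definition theory_imp x A : theory Ax :=
  @Theory L Ax [set B | x (A ⇒ B)] _ _ _.
Next Obligation.
by move=> x A B C BC; apply: theory_up; apply: CL_imp_mono.
Qed.
Next Obligation.
by move=> x A; apply: theory_up (CL_imp_top _ _) _; apply: theory_top.
Qed.
Next Obligation.
move=> x A B C xB xC; apply: theory_up (CL_and_imp _ _ _ _) _.
exact: theory_and.
Qed.

(** The inconsistent theory is kept as a point: it is the element 1 of the frame, where [⊥] must
    hold. *)
Lemma theory_eqT x : x ⊥ -> x = \top.
Proof.
move=> xB; apply: theory_inj; apply/seteqP; split=> // A _.
exact: theory_up (CL_bot _ _) xB.
Qed.

(** * Definable filters and the canonical selection function *)

Definition theory_filt := filt (theory Ax).

Program Definition ext A : theory_filt := @Filt _ (theory Ax) [set x | x A] _ _ _.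
Next Obligation. by move=> A x y /theory_leP xy /xy. Qed.
Next Obligation. by []. Qed.
Next Obligation. by []. Qed.

Program Definition upset x : theory_filt :=
  @Filt _ (theory Ax) [set y | x <= y] _ _ _.
Next Obligation. by move=> x y z yz xy; apply: le_trans yz. Qed.
Next Obligation. by move=> x; apply: lex1. Qed.
Next Obligation. by move=> x y z xy xz; rewrite /= lexI xy. Qed.

(** The principal theory of [A] lies in [ext A], hence in [ext B]. *)
Lemma ext_CL A B : ext A = ext B -> A |- B.
Proof.
move=> eAB; have : ext A (theory_gen A) by apply: CL_refl.
by rewrite eAB.
Qed.

(** Makes [csel] independent of the formula chosen to define its argument. *)
Lemma theory_imp_ext x A B : ext A = ext B -> theory_imp x A = theory_imp x B.
Proof.
move=> eAB; apply: theory_inj; apply/seteqP; split=> C; apply: (@theory_up _ _ x).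
  exact: CL_congl (ext_CL eAB) (ext_CL (esym eAB)).
exact: CL_congl (ext_CL (esym eAB)) (ext_CL eAB).
Qed.

Definition csel x (a : theory_filt) : theory Ax :=
  match pselect (exists A, a = ext A) with
  | left defa => theory_imp x (projT1 (cid defa))
  | right _ => x
  end.

Lemma csel_ext x A : csel x (ext A) = theory_imp x A.
Proof.
rewrite /csel; case: pselect => [defA|[]]; last by exists A.
by case: cid => B /= /esym /theory_imp_ext.
Qed.

(** All that later arguments use about an undefinable filter is that [csel] then fixes every
    point. *)
Lemma definable_ind (P : theory_filt -> Prop) :
  (forall A, P (ext A)) ->
  (forall a, (forall x, csel x a = x) -> P a) -> forall a, P a.
Proof.
move=> Pext Pndef a; have [[A ->] //|ndef] := pselect (exists A, a = ext A).
by apply: Pndef => x; rewrite /csel; case: pselect.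
Qed.

Lemma cselT a : csel \top a = \top.
Proof. by elim/definable_ind: a => // A; rewrite csel_ext; apply: theory_eqT. Qed.

Lemma csel_mono x y a : x <= y -> csel x a <= csel y a.
Proof.
elim/definable_ind: a => [A|a aid] xy; last by rewrite !aid.
by rewrite !csel_ext; apply/theory_leP => B; apply: (theory_leP _ _ xy).
Qed.

(** Supplies [csel x a] and [csel y a] as the witnesses in the meet condition of the canonical
    frame. *)
Lemma cselI x y a : csel (x `&` y) a = csel x a `&` csel y a.
Proof.
elim/definable_ind: a => [A|a aid]; last by rewrite !aid.
by rewrite !csel_ext; apply: theory_inj.
Qed.

Program Definition canonical : sel_frame :=
  @SelFrame _ (theory Ax) (fun x a => upset (csel x a)) _ _ _.
Next Obligation.
move=> a; apply/seteqP; split=> x /=; rewrite cselT; last by move=> ->.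
by rewrite le1x => /eqP.
Qed.
Next Obligation. by move=> x y a xy z; apply/le_trans/csel_mono. Qed.
Next Obligation.
move=> x y a z; rewrite /= cselI => xyz.
by exists (csel x a), (csel y a); split=> /=.
Qed.

End Theories.

(** * Truth lemma and completeness *)

Section Canonical.
Context (L : Type) (Ax : set (cpair L)).
Implicit Types (A B C : formula L) (p q : L).
Notation "A |- B" := (CL Ax (A ⊴ B)) (at level 70).
Notation X := (canonical Ax).
#[local] Obligation Tactic := idtac.


Lemma truth A : interp (fun p => ext Ax (Var p) : filt X) A = ext Ax A.
Proof.
elim: A => [p|||A IHA B IHB|A IHA B IHB|A IHA B IHB] //=;
  rewrite ?IHA ?IHB; apply: filt_inj; apply/seteqP; split=> x //=.
- by move=> _; apply: theory_top.
- by move=> ->.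
- exact: theory_eqT.
- by case=> ? ?; apply: theory_and.
- by move=> xAB; split; apply: theory_up _ xAB; [apply: CL_andl | apply: CL_andr].
- case=> y [z [yA zB /theory_leP yzx]]; apply: yzx; split.
    exact: theory_up (CL_orl _ _ _) yA.
  exact: theory_up (CL_orr _ _ _) zB.
(* A formula in both principal theories follows from [A ∨ B], so it lies in [x]. *)
- move=> xAB; exists (theory_gen Ax A), (theory_gen Ax B).
  split; [exact: CL_refl..|]; apply/theory_leP => C [hA hB].
  by apply: theory_up _ xAB; apply: CL_orE.
(* The selected set is principal, so it suffices to test its least point. *)
- by rewrite csel_ext => /(_ _ (lexx _)).
- by rewrite csel_ext => xAB y /theory_leP; apply.
Qed.

Lemma CL_complete c : validates X c -> CL Ax c.
Proof.
case: c => A B /(_ (fun p => ext Ax (Var p))); rewrite /= !truth.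
by move/(_ (theory_gen Ax A)); apply; apply: CL_refl.
Qed.

(** * Canonicity of the axioms *)

Lemma theory_selector (V : L -> filt X) p x : V p x ->
  exists2 f : L -> theory Ax, f p = x & forall q, V q (f q).
Proof.
(* The default [\top] lies in every filter. *)
move=> Vpx; exists (fun q => if pselect (q = p) then x else \top).
  by case: pselect.
by move=> q; case: pselect => [/= ->|/= _] //; apply: filt_top.
Qed.

Lemma substI_mem (f g : L -> theory Ax) (s : L -> formula L) :
  (forall p, (f p `&` g p) (s p)) ->
  (forall p, f p (s p)) /\ (forall p, g p (s p)).
Proof. by move=> fg; split=> p; case: (fg p). Qed.

(** This is the least theory containing all instances of [A] along [f]. Closure under [∧] merges two
    substitutions into their pointwise conjunction, whose instance lies below both. *)
Program Definition instances (f : L -> theory Ax) A (A_free : imp_free A) :=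
  @Theory L Ax [set B | exists2 s : L -> formula L,
    forall p, f p (s p) & subst s A |- B] _ _ _.
Next Obligation.
by move=> f A _ B C BC [s fs sB]; exists s => //; apply: CL_trans sB BC.
Qed.
Next Obligation.
move=> f A _; exists (fun=> Top) => [p|]; [exact: theory_top|exact: CL_top].
Qed.
Next Obligation.
move=> f A fA B C [s fs sB] [t ft tC].
exists (fun p => And (s p) (t p)) => [p|]; first exact: theory_and.
apply: CL_andI.
  by apply: CL_trans sB; apply: CL_subst_mono => // p; apply: CL_andl.
by apply: CL_trans tC; apply: CL_subst_mono => // p; apply: CL_andr.
Qed.

Lemma interp_instances (V : L -> filt X) A (x : theory Ax) : imp_free A ->
  interp V A x <-> exists2 f : L -> theory Ax, forall p, V p (f p) &
    forall s, (forall p, f p (s p)) -> x (subst s A).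
Proof.
elim: A x => [p|||A IHA B IHB|A IHA B IHB|//] x /=.
- move=> _; split.
    by case/theory_selector=> f <- Vf; exists f.
  case=> f Vf fx; apply: filt_up (Vf p); apply/theory_leP => A fA.
  rewrite -[A](subst1E p); apply: fx => q; rewrite /subst1.
  by case: pselect => [/= ->|/= _] //; apply: theory_top.
- move=> _; split=> // _.
  by exists (fun=> \top) => *; [apply: filt_top|apply: theory_top].
- move=> _; split=> [->|[f Vf]].
    by exists (fun=> \top) => // *; apply: filt_top.
  (* Any substitution along [f] would do, and the constant [⊤] always is one. *)
  by move/(_ (fun=> Top)) => fx; apply: theory_eqT;
    apply: fx => p; apply: theory_top.
- case/andP=> fA fB; split.
    case=> /IHA[//|f Vf fx] /IHB[//|g Vg gx].
    exists (fun p => f p `&` g p) => [p|s /substI_mem[fs gs]].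
      exact: filt_meet.
    by apply: theory_and; [apply: fx | apply: gx].
  case=> f Vf fx; split; [apply/IHA => //|apply/IHB => //]; exists f => // s /fx.
    exact: theory_up (CL_andl _ _ _).
  exact: theory_up (CL_andr _ _ _).
- case/andP=> fA fB; split.
    case=> y [z [/IHA[//|f Vf fy] /IHB[//|g Vg gz] /theory_leP yzx]].
    exists (fun p => f p `&` g p) => [p|s /substI_mem[fs gs]].
      exact: filt_meet.
    apply: yzx; split.
      by apply: theory_up (CL_orl _ _ _) _; apply: fy.
    by apply: theory_up (CL_orr _ _ _) _; apply: gz.
  case=> f Vf fx; exists (instances f fA), (instances f fB); split.
  + by apply/IHA => //; exists f => // s fs; exists s => //; apply: CL_refl.
  + by apply/IHB => //; exists f => // s fs; exists s => //; apply: CL_refl.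
  apply/theory_leP => C [[s fs sC] [t ft tC]].
  (* The instance of [A ∨ B] under the pointwise conjunction of [s] and [t] lies in [x] and entails
     [C] from either disjunct. *)
  have /fx : forall p, f p (And (s p) (t p)) by move=> p; apply: theory_and.
  apply: theory_up; apply: CL_orE.
    by apply: CL_trans sC; apply: CL_subst_mono => // p; apply: CL_andl.
  by apply: CL_trans tC; apply: CL_subst_mono => // p; apply: CL_andr.
Qed.

(** The family [f] depends on the letters only, so one family serves both sides. *)
Lemma canonical_imp_free A B :
  imp_free A -> imp_free B -> A |- B -> validates X (A ⊴ B).
Proof.
move=> fA fB AB V x /= /interp_instances[//|f Vf fx].
apply/interp_instances => //; exists f => // s /fx.
by apply: theory_up; apply: CL_subst.
Qed.

Lemma canonical_admissible c : admissible c -> Ax c -> validates X c.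
Proof.
case=> {c} [p|p q pq|p q pq|p|p|A B fA fB] ax.
- move=> V x /=; elim/definable_ind: (V p) => [A|a aid] [].
    move=> xA xT; apply: theory_eqT; apply: theory_up (CL_pnp A ax) _.
    apply: theory_and => //.
    (* The generator is itself selected, hence inconsistent, which means [A ⇒ ⊥] is in [x]. *)
    have /xT : csel x (ext Ax A) <= csel x (ext Ax A) by [].
    by rewrite csel_ext => e; have : theory_imp x A ⊥ by rewrite e.
  by move=> _; apply; rewrite /= aid.
- move=> V x /=; elim/definable_ind: (V p) => [A|a aid] [].
    (* By [mp] the generator is included in [x], so [x] selects itself. *)
    move=> xA; apply; rewrite /= csel_ext; apply/theory_leP => B xB.
    by apply: theory_up (CL_mp A B pq ax) _; apply: theory_and.
  by move=> _; apply; rewrite /= aid.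
(* Every selected point is above [x], hence stays in [V p]. *)
- move=> V x /= Vx y /= xy; apply: (filt_up _ Vx); apply: le_trans xy.
  elim/definable_ind: (V q) => [B|a ->//].
  rewrite csel_ext; apply/theory_leP => A.
  exact: theory_up (CL_veq _ _ pq ax).
- move=> V x /=; apply.
  have -> : filtT X = ext Ax ⊤.
    by apply: filt_inj; apply/seteqP; split=> // y _; apply: theory_top.
  rewrite csel_ext; apply/theory_leP => A.
  exact: theory_up (CL_det _ ax).
- move=> V x _ y /=.
  (* The filter is definable by [⊥], and [expl] puts [⊥ ⇒ ⊥] in [x], so only the inconsistent theory
     is selected. *)
  have -> : filtB X = ext Ax ⊥.
    by apply: filt_inj; apply/seteqP; split=> y' /= => [->//|/theory_eqT].
  rewrite csel_ext => /theory_leP xy; rewrite [y]theory_eqT; first exact: filt_top.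
  apply: xy; apply: theory_up (CL_expl _ ax) _; exact: theory_top.
- exact/canonical_imp_free/CL_ax.
Qed.

End Canonical.

Theorem theorem5p16 (L : Type) (Ax : set (cpair L))
    (hAx : forall c : cpair L, Ax c -> admissible c) (c : cpair L) :
  CL Ax c <->
  (forall F : sel_frame,
     (forall e : cpair L, Ax e -> validates F e) -> validates F c).
Proof.
split=> [cl F|valid]; first exact: CL_sound.
apply: CL_complete => //; apply: valid => e ax.
exact: canonical_admissible (hAx e ax) ax.
Qed.
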